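(* Let $p<q$ be primes, $a\ge 1$, and let $G=\operatorname{ICG}(p^aq,\mathcal D)$ with $\mathcal D\subseteq\operatorname{Div}^*(p^aq)$. If $G$ is connected, then the ordinary spectrum of $G$ determines $T$ and the exact spectral counting measure $\mathsf M_H$ of $H$, where $\mathcal D=p\mathcal E\mathbin{\dot\cup}T$ and $H=\operatorname{ICG}(p^{a-1}q,\mathcal E)$ are as defined in the context. No connectivity assumption is imposed on $H$, and its divisor set $\mathcal E$ may be empty. Explicitly: if $G=\operatorname{ICG}(p^aq,\mathcal D)$ and $G'=\operatorname{ICG}(p^aq,\mathcal D')$ are both connected and have the same ordinary spectrum, with $\mathcal D=p\mathcal E\mathbin{\dot\cup}T$, $\mathcal D'=p\mathcal E'\mathbin{\dot\cup}T'$, $H=\operatorname{ICG}(p^{a-1}q,\mathcal E)$, $H'=\operatorname{ICG}(p^{a-1}q,\mathcal E')$, then $T=T'$ and $\mathsf M_H=\mathsf M_{H'}$.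
   Context: $\operatorname{Div}^*(n)$ is the set of positive divisors $d$ of $n$ with $d<n$. For $\mathcal D\subseteq\operatorname{Div}^*(n)$, the graph $\operatorname{ICG}(n,\mathcal D)$ has vertex set $\mathbb Z/n\mathbb Z$, with $x,y$ adjacent iff $\gcd(x-y,n)\in\mathcal D$. All its adjacency eigenvalues are integers. The ordinary spectrum is the multiset of adjacency eigenvalues. Every $\mathcal D\subseteq\operatorname{Div}^*(p^aq)$ has a unique decomposition $\mathcal D=p\mathcal E\mathbin{\dot\cup}T$ with $T=\mathcal D\cap\{1,q\}$, $\mathcal E\subseteq\operatorname{Div}^*(p^{a-1}q)$ and $p\mathcal E=\{pe:e\in\mathcal E\}$. Let $\mathcal A$ be the free abelian group with basis $\{[z]:z\in\mathbb Z\}$. The spectral counting measure of an integral circulant graph $G$ is $\mathsf M_G=\sum_{z\in\mathbb Z}m_G(z)[z]\in\mathcal A$, where $m_G(z)$ is the multiplicity of $z$ as an adjacency eigenvalue of $G$. *)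

(* Defs.v *)
From HB Require Import structures.
From mathcomp Require Export all_boot all_order all_algebra all_field.
From mathcomp Require Export finmap multiset.
From mathcomp Require Import boolp classical_sets functions cardinality fsbigop.
From mathcomp Require Export freeg.

Set Implicit Arguments.
Unset Strict Implicit.
Unset Printing Implicit Defensive.

Import GRing.Theory.
Local Open Scope mset_scope.
Local Open Scope fset_scope.
Local Open Scope ring_scope.

Definition Divstar (n : nat) : {fset nat} := [fset d in divisors n | (d < n)%N].

(* Meaningful for n > 1 only: 'Z_n is Z/nZ exactly when n > 1. The gcd is
   computed on the representative of x - y in {0, ..., n - 1}. *)
Definition ICG (n : nat) (D : {fset nat}) : rel 'Z_n :=
  fun x y => gcdn (x - y)%R n \in D.
Arguments ICG : clear implicits.

Definition graph_connected (V : finType) (e : rel V) : Prop :=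
  forall x y : V, connect e x y.

Definition adjmx (m : nat) (e : rel 'I_m) : 'M[algC]_m :=
  \matrix_(x, y) (e x y)%:R.

Definition spectrum (m : nat) (e : rel 'I_m) : {mset algC} :=
  seq_mset (sval (closed_field_poly_normal (char_poly (adjmx e)))).

Definition int_mult (m : nat) (e : rel 'I_m) (z : int) : nat :=
  spectrum e z%:~R.

(* The sum has finite support (int_mult_finite), so that it is the genuine one
   and not the default value 0 of \sum_(_ \in _); see coeff_spectral_measure. *)
Definition spectral_measure (m : nat) (e : rel 'I_m) : {freeg int / int} :=
  \sum_(z \in [set: int]%classic) << (int_mult e z)%:Z *g z >>.

Definition decomposition (p q a : nat) (D E T : {fset nat}) : Prop :=
  [/\ E `<=` Divstar (p ^ a.-1 * q)%N,
      T = D `&` [fset 1%N; q],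
      [disjoint [fset (p * e)%N | e in E] & T]
    & D = [fset (p * e)%N | e in E] `|` T].

Lemma spectrumE (m : nat) (e : rel 'I_m) (x : algC) :
  spectrum e x = mup x (char_poly (adjmx e)).
Proof.
rewrite /spectrum mset_seqE; case: closed_field_poly_normal => s /= ->.
rewrite (monicP (char_poly_monic _)) scale1r.
elim: s => [|y s IHs]; first by rewrite big_nil /= mupNroot // root1.
rewrite big_cons mupM ?polyXsubC_eq0 ?monic_neq0 ?monic_prod_XsubC //.
by rewrite /= IHs -['X - _]expr1 mup_XsubCX; case: eqP.
Qed.

Lemma int_mult_finite (m : nat) (e : rel 'I_m) :
  finite_set [set z : int | int_mult e z != 0%N]%classic.
Proof.
rewrite /int_mult /spectrum; set s := sval _.
apply: (@sub_finite_set _ _ (Num.floor @` [set` s])%classic); last first.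
  exact/finite_image/finite_seq.
move=> z /=; rewrite mset_seqE -lt0n -has_count has_pred1 => zs.
by exists z%:~R => //; rewrite Num.Theory.intrKfloor.
Qed.

Lemma coeff_spectral_measure (m : nat) (e : rel 'I_m) (z : int) :
  coeff z (spectral_measure e) = (int_mult e z)%:Z.
Proof.
have [r ur rE] : exists2 r : seq int, uniq r &
    forall x, (x \in r) = (int_mult e x != 0%N).
  have /finite_seqP[r rE] := int_mult_finite e.
  exists (undup r); first exact: undup_uniq.
  move=> x; rewrite mem_undup; apply/idP/idP => hx.
    by have : [set` r]%classic x by []; rewrite -rE.
  by have : [set z | int_mult e z != 0%N]%classic x by []; rewrite rE.
rewrite /spectral_measure -(fsbig_widen [set` r]%classic) //; last first.
  move=> x /= [_ xr]; have : x \notin r by apply/negP.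
  rewrite rE negbK => /eqP ->; apply/eqP/freeg_eqP => k.
  by rewrite coeffU coeff0 mul0r.
rewrite -fsbig_seq // raddf_sum /=.
under eq_bigr do rewrite coeffU.
have [zr|zr] := boolP (z \in r).
  rewrite (bigD1_seq z) //= eqxx mulr1 big1 ?addr0 // => i /negPf ->.
  by rewrite mulr0.
rewrite big_seq big1 => [|i ir].
  by move: zr; rewrite rE negbK => /eqP ->.
by case: eqP ir zr => [-> ->//|_ _ _]; rewrite mulr0.
Qed.

Lemma decomposition_exists_unique (p q a : nat) (D : {fset nat}) :
  prime p -> prime q -> (p < q)%N -> (0 < a)%N ->
  D `<=` Divstar (p ^ a * q)%N ->
  exists! ET : {fset nat} * {fset nat}, decomposition p q a D ET.1 ET.2.
Proof.
move=> pp pq ltpq a0 DS.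
have p0 := prime_gt0 pp; have q0 := prime_gt0 pq.
have pN1 : ~~ (p %| 1)%N by rewrite dvdn1 neq_ltn prime_gt1 ?orbT.
have pNq : ~~ (p %| q)%N by rewrite dvdn_prime2 // ltn_eqF.
have NE : (p ^ a * q = p * (p ^ a.-1 * q))%N by rewrite -[in LHS](prednK a0) expnS mulnA.
have DstE n d : (0 < n)%N -> (d \in Divstar n) = (d %| n)%N && (d < n)%N.
  by move=> n0; rewrite !inE /= -dvdn_divisors.
have N0 : (0 < p ^ a.-1 * q)%N by rewrite muln_gt0 expn_gt0 p0.
have mulpI : injective (muln p) by move=> x y /eqP; rewrite eqn_pmul2l // => /eqP.
have inpE (E : {fset nat}) e : ((p * e)%N \in [fset (p * e)%N | e in E]) = (e \in E).
  by rewrite mem_imfset.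
exists ([fset e in Divstar (p ^ a.-1 * q) | (p * e)%N \in D], D `&` [fset 1%N; q]).
split=> /= [|[E T] /= [ES TE dj DE]].
  split=> //.
  - by apply/fsubsetP => x; rewrite !inE => /andP[].
  - apply/fdisjointP => x /imfsetP[e /= _ ->]; rewrite !inE negb_and.
    by apply/orP; right; apply/negP=> /orP[] /eqP h;
      [move: pN1|move: pNq]; rewrite -h dvdn_mulr.
  apply/fsetP => d; rewrite inE; apply/idP/idP => [dD|]; last first.
    case/orP => [/imfsetP[e /= + ->]|]; rewrite !inE; first by case/andP.
    by case/andP.
  have := fsubsetP DS _ dD; rewrite DstE ?NE ?muln_gt0 ?expn_gt0 ?p0 ?q0 // => /andP[ddv dlt].
  have [/dvdnP[e de]|pNd] := boolP (p %| d)%N.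
    apply/orP; left; rewrite de mulnC inpE; move: dD ddv dlt.
    rewrite de mulnC dvdn_pmul2l // ltn_pmul2l // => h1 h2 h3.
    by rewrite inE /= inE DstE // h2 h3 h1.
  apply/orP; right; rewrite !inE dD /=.
  have : (d %| q)%N.
    move: ddv; rewrite -NE Gauss_dvdr // coprime_sym coprimeXl //.
    by rewrite prime_coprime.
  by move/primeP: pq => [_ /[apply]].
congr pair => //; apply/fsetP => e; rewrite inE /= inE.
apply/andP/idP => [[_]|eE].
  rewrite DE inE inpE => /orP[//|]; rewrite TE !inE => /andP[_ /orP[]/eqP h];
    [move: pN1|move: pNq]; by rewrite -h dvdn_mulr.
by rewrite (fsubsetP ES) // DE inE inpE eE.
Qed.

(* Main.v *)
Require Import Defs.
From mathcomp Require Import zify ring.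
Import Order.TTheory GRing.Theory Num.Theory.

(** Write n = p^a q, P = p^(a-1). A circulant graph is diagonalised by the
    characters of Z/n, so its spectrum is the family of character sums
    lambda_k, k in Z/n. Here lambda_k is a sum of Ramanujan sums c_(p^i)(k) and
    c_(p^i q)(k), and it depends only on gcd(k, n). Let A_i and B_i be its
    values at gcd p^(a-i) q and p^(a-i). Then

      M_G = sum_(i <= a) phi(p^i) ([A_i] + (q - 1) [B_i])

    ([eigmult_levels]). A divisor e of n/p and the divisor pe of n have the same
    cofactor and give the same Ramanujan sum, so G and H have the same values at
    all k that P does not divide: only the elements of T have a cofactor
    divisible by p^a, and their Ramanujan sums vanish there. If
    r = A_0(H), s = B_0(H), x = (q - 1) [1 in D] + [q in D] and
    y = [q in D] - [1 in D], the two top levels of G are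

      A_0 = r + P(p-1)x,   A_1 = r - Px,   B_0 = s + P(p-1)y,   B_1 = s - Py,

    and M_G - p M_H is an explicit measure depending on r, s, x, y, in which s
    drops out when y = 0 ([eigmultS]). As p is not a zero divisor in the free abelian group, it is
    enough to recover T, r and, when y <> 0, also s from M_G.

    The degree A_0 is the largest eigenvalue, so M_G determines it. Now compare
    G and G', and let p^e be the exact power of p dividing q - 1. Modulo p^i
    with i <= e, the B part and the levels beyond i vanish from M_G, which shows
    one after the other that A_i = A'_i for i <= e ([eq_div_levels]). Modulo
    p^(e+1) only [A_(e+1)], [B_0] and [B_1] survive ([levels_congr]).

    - s = s'. Suppose T = T', y <> 0 and s <> s'. As -P <= s, s' < P, the number
      |s - s'| is smaller than pP = |B_0 - B_1|, so that B_0, B_1, B'_0, B'_1 are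
      four distinct integers, all occurring with a coefficient that is nonzero
      modulo p^(e+1). The levels A_(e+1), A'_(e+1) can cancel only two of them
      ([eq_ndiv_level0]).

    - T = T'. If e > 0, then A_1 = A'_1 and A_0 - A_1 = pPx give x = x'. If
      e = 0, the congruence modulo p is read at the single point B_0 of a graph
      with y <> 0: its coefficient there is q - 1, q or 2(q - 1) modulo p up to
      sign, none of which is zero: p does not divide q - 1, so p is odd
      ([no_top_clash]). This uses
      connectedness: D has an element prime to p, so T is nonempty, and an
      element prime to q, so A_0 <> B_0. *)

Set Implicit Arguments.
Unset Strict Implicit.
Unset Printing Implicit Defensive.
Local Open Scope fset_scope.
Local Open Scope ring_scope.

(** * Diagonalisation of circulant matrices *)

Lemma char_poly_conj (K : fieldType) (m : nat) (A F L : 'M[K]_m) :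
  F \in unitmx -> A *m F = F *m L -> char_poly A = char_poly L.
Proof.
move=> Fu AF; have F0 : \det (map_mx polyC F) != 0.
  by rewrite det_map_mx polyC_eq0 -unitfE -unitmxE.
apply: (mulIf F0); rewrite [RHS]mulrC /char_poly -!det_mulmx; congr (\det _).
rewrite /char_poly_mx mulmxBl mulmxBr -!map_mxM AF.
by rewrite mul_scalar_mx mul_mx_scalar.
Qed.

Lemma prim_root_Zn_morph (n : nat) (w : algC) (k : nat) (x y : 'Z_n) :
  (1 < n)%N -> n.-primitive_root w ->
  w ^+ (k * (x + y)%R) = w ^+ (k * x) * w ^+ (k * y).
Proof.
move=> n1 wp; rewrite -exprD -mulnDr /= [X in (_ %% X)%N]Zp_cast // mulnC exprM.
by rewrite (prim_expr_mod wp) -exprM mulnC.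
Qed.

(** The characters of Z/n are eigenvectors of a circulant matrix, and the matrix
    they form is a Vandermonde matrix, which is invertible because the powers
    of a primitive root are distinct. *)
Lemma char_poly_circulant (n : nat) (w : algC) (f : 'Z_n -> algC) :
  (1 < n)%N -> n.-primitive_root w ->
  char_poly (\matrix_(x, y) f (x - y))
    = \prod_(k : 'Z_n) ('X - (\sum_(z : 'Z_n) f z * w ^+ (k * z))%:P).
Proof.
move=> n1 wp; have w0 : w != 0.
  apply: contra_eq_neq (prim_expr_order wp) => ->.
  by rewrite expr0n (gtn_eqF (prim_order_gt0 wp)) eq_sym oner_eq0.
(* Inverse powers of w, so that the eigenvalues come out as sums of f against
   the powers of w itself. *)
pose F := @Vandermonde algC (Zp_trunc n).+2 (Zp_trunc n).+2 (\row_k w^-1 ^+ k).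
pose L := diag_mx (\row_(k < (Zp_trunc n).+2) (\sum_(z : 'Z_n) f z * w ^+ (k * z))).
rewrite (@char_poly_conj _ _ _ F L).
- rewrite char_poly_trig; last by apply/is_trig_mxP => i j ij; rewrite !mxE -val_eqE /= ltn_eqF.
  by apply: eq_bigr => k _; rewrite !mxE eqxx.
- rewrite unitmxE unitfE det_Vandermonde; apply/prodf_neq0 => i _.
  apply/prodf_neq0 => j ij; rewrite !mxE subr_eq0 !exprVn.
  rewrite (inj_eq invr_inj) (eq_prim_root_expr wp).
  have ltn x : (x < (Zp_trunc n).+2)%N -> (x < n)%N by rewrite Zp_cast.
  by rewrite !modn_small ?gtn_eqF // ltn.
apply/matrixP => x k; rewrite mul_mx_diag !mxE big_distrr /=.
rewrite (reindex (fun z : 'Z_n => x - z)) /=; last first.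
  by exists (fun z : 'Z_n => x - z) => z _; rewrite subKr.
apply: eq_bigr => z _; rewrite !mxE subKr mulrCA; congr (_ * _).
rewrite -!exprM !exprVn.
have wX e : w ^+ e != 0 by rewrite expf_neq0.
have := prim_root_Zn_morph k (x - z) z n1 wp; rewrite subrK => ->.
by rewrite invfM mulrVK ?unitfE.
Qed.

(** * Character sums over gcd classes *)

Lemma sum_multiples (V : nmodType) (M g : nat) (F : nat -> V) : (0 < g)%N ->
  \sum_(0 <= z < M * g | (g %| z)%N) F z = \sum_(0 <= t < M) F (t * g)%N.
Proof.
move=> g0; elim: M => [|M IH]; first by rewrite mul0n !big_nil.
rewrite big_nat_recr //= -IH mulSnr (big_cat_nat (n := (M * g)%N)) //= ?leq_addr //.
congr (_ + _); rewrite big_ltn_cond; last by rewrite -[X in (X < _)%N]addn0 ltn_add2l.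
rewrite dvdn_mull // big_nat_cond big_pred0 ?addr0 // => z.
apply/negP => /andP[/andP[h1 h2] /dvdnP[t zE]].
by move: h1 h2; rewrite zE -mulSnr !ltn_pmul2r // => ? ?; lia.
Qed.

(** The multiples of m form the subgroup of index m, on which the k-th character
    is trivial exactly when n/m divides k. *)
Lemma sum_root_multiples (n m k : nat) (w : algC) :
  n.-primitive_root w -> (m %| n)%N ->
  \sum_(0 <= z < n) (m %| z)%N%:R * w ^+ (k * z)
    = (n %/ m * (n %/ m %| k))%N%:R.
Proof.
move=> wp mn; have n0 := prim_order_gt0 wp.
have m0 : (0 < m)%N by apply: dvdn_gt0 mn.
pose M := (n %/ m)%N; have nE : n = (M * m)%N by rewrite divnK.
rewrite -/M.
transitivity (\sum_(0 <= z < M * m | (m %| z)%N) w ^+ (k * z)).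
  rewrite [RHS]big_mkcond nE; apply: eq_bigr => z _.
  by case: ifP => _; rewrite ?mul1r ?mul0r.
rewrite sum_multiples //.
under eq_bigr do rewrite mulnCA mulnC exprM.
have vE : (w ^+ (k * m) == 1) = (M %| k)%N.
  by rewrite -(prim_order_dvd wp) nE dvdn_pmul2r.
rewrite big_mkord; case: (boolP (M %| k)%N) vE => _ vE.
  rewrite (eqP vE); under eq_bigr do rewrite expr1n.
  by rewrite sumr_const card_ord muln1.
have v1 : w ^+ (k * m) - 1 != 0 by rewrite subr_eq0 vE.
apply: (mulfI v1); rewrite -subrX1 -exprM -mulnA [(m * M)%N]mulnC -nE mulnC.
by rewrite exprM (prim_expr_order wp) expr1n subrr muln0 mulr0.
Qed.

(** The Ramanujan sum c_(p^i)(k), in closed form. *)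
Definition ram (p i k : nat) : int :=
  if i is j.+1 then (p ^ i * (p ^ i %| k))%N%:Z - (p ^ j * (p ^ j %| k))%N%:Z
  else 1.

(** The eigenvalue of ICG(p^a q, D) at k when S i and R i say whether p^(a-i) and
    p^(a-i) q belong to D. The divisors p^(a-i) and p^(a-i) q contribute the
    Ramanujan sums of modulus p^i q and p^i: indexing D by the modulus makes S
    and R independent of a when p^a q is replaced by p^(a-1) q and pe by e. *)
Definition eigval (p q : nat) (S R : nat -> bool) (a k : nat) : int :=
  \sum_(i < a.+1) ram p i k * ((S i)%:Z * ((q * (q %| k))%N%:Z - 1) + (R i)%:Z).

Section Divisors.
Variables (p q : nat).
Hypotheses (pp : prime p) (pq : prime q) (ltpq : (p < q)%N).

Lemma dvd_pXq (a d : nat) : (d %| p ^ a * q)%N ->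
  exists2 i, (i <= a)%N & d = (p ^ i)%N \/ d = (p ^ i * q)%N.
Proof.
move=> dn; have [qd|qNd] := boolP (q %| d)%N.
  have /dvdnP[c dE] := qd; move: dn; rewrite dE dvdn_pmul2r ?prime_gt0 //.
  by case/(dvdn_pfactor _ _ pp) => i ia ->; exists i => //; right.
have : (d %| p ^ a)%N.
  by move: dn; rewrite Gauss_dvdl // coprime_sym prime_coprime.
by case/(dvdn_pfactor _ _ pp) => i ia ->; exists i => //; left.
Qed.

Lemma qNdvd_pX (i : nat) : (q %| p ^ i)%N = false.
Proof.
apply/negbTE; rewrite -prime_coprime // coprimeXr // prime_coprime //.
by rewrite dvdn_prime2 // gtn_eqF.
Qed.

Lemma pX_dvd_pXq (i j : nat) : (p ^ i %| p ^ j * q)%N = (i <= j)%N.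
Proof.
rewrite Gauss_dvdl ?dvdn_Pexp2l ?prime_gt1 //.
by rewrite coprimeXl // prime_coprime // dvdn_prime2 // ltn_eqF.
Qed.

Lemma pXq_dvd_pXq (i j : nat) : (p ^ i * q %| p ^ j * q)%N = (i <= j)%N.
Proof. by rewrite dvdn_pmul2r ?prime_gt0 // dvdn_Pexp2l ?prime_gt1. Qed.

Lemma pXq_dvd_pX (i j : nat) : (p ^ i * q %| p ^ j)%N = false.
Proof.
apply/negbTE/negP => h; have := qNdvd_pX j.
by rewrite (dvdn_trans _ h) // dvdn_mull.
Qed.

Lemma eqn_pX (i j : nat) : (p ^ i == p ^ j)%N = (i == j).
Proof. by rewrite eqn_exp2l ?prime_gt1. Qed.

Lemma eqn_pXq (i j : nat) : (p ^ i * q == p ^ j * q)%N = (i == j).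
Proof. by rewrite eqn_pmul2r ?prime_gt0 // eqn_pX. Qed.

Lemma neq_pX_pXq (i j : nat) : (p ^ i == p ^ j * q)%N = false.
Proof. by apply/eqP => h; have := pXq_dvd_pX j i; rewrite h dvdnn. Qed.

(** Lets a sum over Z/n of a function of gcd(k, n) be exchanged with a sum over
    the divisors of n; it is used both for the indicator of D and for
    multiplicities. *)
Lemma divisor_expansion (V : pzRingType) (a g : nat) (F : nat -> V) :
  (g %| p ^ a * q)%N ->
  F g = \sum_(i < a.+1) ((g == p ^ (a - i))%N%:R * F (p ^ (a - i))%N
                         + (g == p ^ (a - i) * q)%N%:R * F (p ^ (a - i) * q)%N).
Proof.
case/dvd_pXq => j ja gE; have lt : (a - j < a.+1)%N by rewrite ltnS leq_subr.
rewrite (bigD1 (Ordinal lt)) //= subKn // big1 ?addr0.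
  case: gE => ->; rewrite eqxx mul1r ?neq_pX_pXq ?mul0r ?addr0 //.
  by rewrite eq_sym neq_pX_pXq mul0r add0r.
move=> i; rewrite -val_eqE /= => iN; have ia := ltn_ord i.
have ne : (j == a - i)%N = false by lia.
case: gE => ->; rewrite ?eqn_pX ?eqn_pXq ?ne ?neq_pX_pXq ?mul0r ?addr0 //.
by rewrite eq_sym neq_pX_pXq !mul0r.
Qed.

Lemma count_gcd (V : pzRingType) (n g : nat) : (0 < n)%N -> (g %| n)%N ->
  \sum_(0 <= z < n) (gcdn z n == g)%N%:R = (totient (n %/ g))%:R :> V.
Proof.
move=> n0 gn; have g0 : (0 < g)%N by apply: dvdn_gt0 gn.
pose M := (n %/ g)%N; have nE : n = (M * g)%N by rewrite divnK.
rewrite -/M.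
transitivity (\sum_(0 <= z < M * g | (g %| z)%N) ((gcdn z n == g)%N%:R : V)).
  rewrite [RHS]big_mkcond nE; apply: eq_bigr => z _.
  by case: ifP => // /negbT; case: eqP => // <-; rewrite dvdn_gcdl.
rewrite sum_multiples // totient_count_coprime natr_sum; apply: eq_bigr => t _.
by rewrite nE -muln_gcdl -{2}[g]mul1n eqn_pmul2r // /coprime gcdnC.
Qed.

Lemma divn_pXq (a i : nat) : (i <= a)%N ->
  (p ^ a * q %/ (p ^ (a - i) * q) = p ^ i)%N.
Proof.
by move=> ia; rewrite divnMr ?prime_gt0 // -expnB ?leq_subr ?prime_gt0 ?subKn.
Qed.

Lemma divn_pX (a i : nat) : (i <= a)%N ->
  (p ^ a * q %/ p ^ (a - i) = p ^ i * q)%N.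
Proof.
move=> ia; rewrite -[in LHS](subnK ia) expnD -mulnA subnK //.
by rewrite mulKn ?expn_gt0 ?prime_gt0.
Qed.

Lemma sum_gcd (a : nat) (F : nat -> int) :
  (forall k, F (gcdn k (p ^ a * q)) = F k) ->
  \sum_(0 <= k < p ^ a * q) F k
    = \sum_(i < a.+1) (totient (p ^ i))%:Z
         * (F (p ^ (a - i) * q)%N + (q.-1)%:Z * F (p ^ (a - i))%N).
Proof.
move=> Fg; have n0 : (0 < p ^ a * q)%N by rewrite muln_gt0 expn_gt0 !prime_gt0.
under eq_bigr => k _ do
  rewrite -Fg (divisor_expansion F (dvdn_gcdr k (p ^ a * q))).
rewrite exchange_big /=; apply: eq_bigr => i _.
have ia : (i <= a)%N by rewrite -ltnS.
rewrite big_split /= -!mulr_suml !count_gcd //; last first.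
- by rewrite pX_dvd_pXq leq_subr.
- by rewrite pXq_dvd_pXq leq_subr.
rewrite divn_pXq // divn_pX // totient_coprime; last first.
  by rewrite coprimeXl // prime_coprime // dvdn_prime2 // ltn_eqF.
rewrite (totient_prime pq) natrM !natz; ring.
Qed.

(** Inclusion-exclusion: a gcd class becomes a combination of sets of multiples,
    whose character sums are known. The condition 0 < i removes the term that
    would come from the non-divisor p^(a+1). *)
Lemma gcd_eq_pXq (a i z : nat) : (i <= a)%N ->
  (gcdn z (p ^ a * q) == p ^ (a - i) * q)%N%:R
   = (p ^ (a - i) * q %| z)%N%:R
     - ((0 < i) && (p ^ (a - i).+1 * q %| z))%N%:R :> algC.
Proof.
move=> ia; set n := (p ^ a * q)%N.
have dE m : (m %| n)%N -> (m %| z)%N = (m %| gcdn z n)%N.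
  by move=> mn; rewrite dvdn_gcd mn andbT.
have [j ja gE] := dvd_pXq (dvdn_gcdr z n).
rewrite (dE (p ^ (a - i) * q)%N) ?pXq_dvd_pXq ?leq_subr //.
have -> : (0 < i)%N && (p ^ (a - i).+1 * q %| z)%N
   = (0 < i)%N && (p ^ (a - i).+1 * q %| gcdn z n)%N.
  case: ltnP => //= i0; rewrite dE // pXq_dvd_pXq; lia.
case: gE => ->; rewrite ?pXq_dvd_pX ?pXq_dvd_pXq ?neq_pX_pXq ?eqn_pXq ?andbF ?subr0 //.
case: (ltngtP j (a - i)) => h; case: ltnP => i0 //=; rewrite ?subr0 ?subrr //; lia.
Qed.

Lemma gcd_eq_pX (a i z : nat) : (i <= a)%N ->
  (gcdn z (p ^ a * q) == p ^ (a - i))%N%:R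
   = ((p ^ (a - i) %| z)%N%:R - ((0 < i) && (p ^ (a - i).+1 %| z))%N%:R)
   - ((p ^ (a - i) * q %| z)%N%:R
     - ((0 < i) && (p ^ (a - i).+1 * q %| z))%N%:R) :> algC.
Proof.
move=> ia; set n := (p ^ a * q)%N.
have dE m : (m %| n)%N -> (m %| z)%N = (m %| gcdn z n)%N.
  by move=> mn; rewrite dvdn_gcd mn andbT.
have [j ja gE] := dvd_pXq (dvdn_gcdr z n).
rewrite -gcd_eq_pXq // -/n (dE (p ^ (a - i))%N) ?pX_dvd_pXq ?leq_subr //.
have -> : (0 < i)%N && (p ^ (a - i).+1 %| z)%N
   = (0 < i)%N && (p ^ (a - i).+1 %| gcdn z n)%N.
  case: ltnP => //= i0; rewrite dE // pX_dvd_pXq; lia.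
have Pp := prime_gt1 pp.
case: gE => ->; rewrite ?pX_dvd_pXq ?dvdn_Pexp2l ?neq_pX_pXq ?eqn_pXq ?eqn_pX //;
  rewrite 1?[(_ * _ == p ^ _)%N]eq_sym ?neq_pX_pXq;
  case: (ltngtP j (a - i)) => h; case: ltnP => i0 //=; rewrite ?subr0 ?subrr //; lia.
Qed.

Lemma sum_root_gcd_q (a i k : nat) (w : algC) :
  (p ^ a * q).-primitive_root w -> (i <= a)%N ->
  \sum_(0 <= z < p ^ a * q) ((p ^ (a - i) * q %| z)%N%:R
     - ((0 < i) && (p ^ (a - i).+1 * q %| z))%N%:R) * w ^+ (k * z)
  = (ram p i k)%:~R.
Proof.
move=> wp ia; under eq_bigr do rewrite mulrBl.
rewrite sumrB (sum_root_multiples _ wp) ?pXq_dvd_pXq ?leq_subr //.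
rewrite divn_pXq //.
case: i ia => [|i] ia /=.
  by rewrite expn0 dvd1n muln1 big1 ?subr0 // => z _; rewrite mul0r.
rewrite (sum_root_multiples _ wp) ?pXq_dvd_pXq; last by lia.
have -> : ((a - i.+1).+1 = a - i)%N by lia.
rewrite divn_pXq; last by lia.
by rewrite rmorphB.
Qed.

Lemma sum_root_gcd_p_part (a i k : nat) (w : algC) :
  (p ^ a * q).-primitive_root w -> (i <= a)%N ->
  \sum_(0 <= z < p ^ a * q) ((p ^ (a - i) %| z)%N%:R
     - ((0 < i) && (p ^ (a - i).+1 %| z))%N%:R) * w ^+ (k * z)
  = (ram p i k * (q * (q %| k))%N%:Z)%:~R.
Proof.
have cop j : coprime (p ^ j) q.
  by rewrite coprimeXl // prime_coprime // dvdn_prime2 // ltn_eqF.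
move=> wp ia; under eq_bigr do rewrite mulrBl.
rewrite sumrB (sum_root_multiples _ wp) ?pX_dvd_pXq ?leq_subr // divn_pX //.
case: i ia => [|i] ia /=.
  rewrite expn0 mul1n mul1r big1 ?subr0 // => z _; first by rewrite mul0r.
rewrite (sum_root_multiples _ wp) ?pX_dvd_pXq; last by lia.
have -> : ((a - i.+1).+1 = a - i)%N by lia.
rewrite divn_pX; last by lia.
rewrite !Gauss_dvd; try exact: cop.
rewrite -!mulnb intrM intrB -!pmulrn !natrM; ring.
Qed.

(** Summing the characters over the gcd classes that make up D gives the
    Ramanujan sums; the class of p^(a-i) is the difference of two families of
    multiples, whence the factor q [q | k] - 1 = c_q(k). *)
Lemma ICG_eigenvalue (a k : nat) (w : algC) (D : {fset nat}) :
  (p ^ a * q).-primitive_root w ->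
  \sum_(0 <= z < p ^ a * q) (gcdn z (p ^ a * q) \in D)%:R * w ^+ (k * z)
  = (eigval p q (fun i => (p ^ (a - i))%N \in D)
                (fun i => (p ^ (a - i) * q)%N \in D) a k)%:~R.
Proof.
move=> wp.
under eq_bigr => z _ do
  rewrite (divisor_expansion (fun g => (g \in D)%:R) (dvdn_gcdr z (p ^ a * q)))
          mulr_suml.
rewrite exchange_big /eigval rmorph_sum /=; apply: eq_bigr => i _.
have ia : (i <= a)%N by rewrite -ltnS.
under eq_bigr => z _ do rewrite gcd_eq_pX // gcd_eq_pXq //.
set x1 := (_ \in D)%:R; set x2 := (_ \in D)%:R.
transitivity (x1 * ((ram p i k * (q * (q %| k))%N%:Z)%:~R - (ram p i k)%:~R)
              + x2 * (ram p i k)%:~R).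
  rewrite -(sum_root_gcd_p_part k wp ia) -(sum_root_gcd_q k wp ia) -sumrB !mulr_sumr -big_split /=.
  by apply: eq_bigr => z _; ring.
rewrite !(rmorphM, rmorphD, rmorphB, rmorph1) /= /x1 /x2; ring.
Qed.

End Divisors.

Lemma int_mult_ICG (p q a : nat) (D : {fset nat}) (z : int) :
  prime p -> prime q -> (p < q)%N ->
  int_mult (ICG (p ^ a * q) D) z
   = (\sum_(0 <= k < p ^ a * q)
        (eigval p q (fun i => (p ^ (a - i))%N \in D)
                    (fun i => (p ^ (a - i) * q)%N \in D) a k == z))%N.
Proof.
move=> pp pq ltpq; set n := (p ^ a * q)%N.
have n1 : (1 < n)%N.
  rewrite (leq_trans (prime_gt1 pq)) // leq_pmull ?expn_gt0 ?prime_gt0 //.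
have [w wp] := C_prim_root_exists (ltnW n1).
rewrite /int_mult spectrumE.
pose f (u : 'Z_n) : algC := (gcdn u n \in D)%:R.
have -> : adjmx (ICG n D) = \matrix_(x, y) f (x - y).
  by apply/matrixP => x y; rewrite !mxE.
rewrite (char_poly_circulant _ n1 wp).
have big_Zn (V : nmodType) (F : nat -> V) :
    \sum_(z < (Zp_trunc n).+2) F z = \sum_(0 <= z < n) F z.
  by rewrite big_mkord; have e := Zp_cast n1; rewrite -(big_mkord xpredT F) e big_mkord.
rewrite -big_Zn -(big_map _ xpredT (fun y => 'X - y%:P)) mu_prod_XsubC.
rewrite count_map -sum1_count big_mkcond /=.
apply: eq_bigr => k _.
rewrite (big_Zn _ (fun z => (gcdn z n \in D)%:R * w ^+ (k * z))) ICG_eigenvalue //.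
by rewrite eqr_int; case: eqP.
Qed.

(** * Eigenvalues by level *)

Definition eigmult (p q : nat) (S R : nat -> bool) (a : nat) (z : int) : int :=
  \sum_(0 <= k < p ^ a * q) (eigval p q S R a k == z)%:Z.

(** The values A_i (k divisible by q) and B_i (k prime to q) of the eigenvalue
    function at level i, that is for k with p-part p^(a-i) in p^a q. *)
Definition eigdiv (p q : nat) (S R : nat -> bool) (a i : nat) : int :=
  eigval p q S R a (p ^ (a - i) * q).

Definition eigndiv (p q : nat) (S R : nat -> bool) (a i : nat) : int :=
  eigval p q S R a (p ^ (a - i)).

(** The value at k = 0 of the sum of the Ramanujan sums c_(p^i) over the i with
    S i. It expresses the level-0 eigenvalues. *)
Definition weight (p : nat) (S : nat -> bool) (a : nat) : int :=
  \sum_(i < a.+1) (totient (p ^ i))%:Z * (S i)%:Z.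

Lemma PoszX (m n : nat) : (m ^ n)%N%:Z = m%:Z ^+ n.
Proof. by rewrite -natz natrX natz. Qed.

Lemma totient_pX0 (p : nat) : (totient (p ^ 0))%:Z = 1.
Proof. by []. Qed.

Section PrimePowers.
Variable p : nat.
Hypothesis pp : prime p.

Lemma totient_pXS (i : nat) :
  (totient (p ^ i.+1))%:Z = p%:Z ^+ i * (p%:Z - 1).
Proof.
have -> : p%:Z - 1 = (p.-1)%:Z by have := prime_gt0 pp; lia.
by rewrite totient_pfactor // PoszM mulrC PoszX.
Qed.

Lemma ram_dvd (i k : nat) : (p ^ i %| k)%N -> ram p i k = (totient (p ^ i))%:Z.
Proof.
case: i => [|i] pk //; rewrite totient_pXS //= pk.
have -> : (p ^ i %| k)%N by apply: dvdn_trans pk; rewrite dvdn_exp2l.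
rewrite !muln1 !PoszX exprS; ring.
Qed.

Lemma ram_exact (i : nat) k : (p ^ i %| k)%N -> (p ^ i.+1 %| k)%N = false ->
  ram p i.+1 k = - p%:Z ^+ i.
Proof. by move=> pk pNk; rewrite /= pk pNk muln0 muln1 sub0r PoszX. Qed.

Lemma ram_ndvd (i k : nat) : (p ^ i %| k)%N = false -> ram p i.+1 k = 0.
Proof.
move=> pNk; rewrite /= pNk; case: (boolP (p ^ i.+1 %| k)%N) => [pk|_].
  by rewrite (dvdn_trans _ pk) ?dvdn_exp2l in pNk.
by rewrite !muln0.
Qed.

Lemma ram_le (i k : nat) : `|ram p i k| <= (totient (p ^ i))%:Z.
Proof.
case: i => [|i]; first by rewrite /= expn0.
have p1 := prime_gt1 pp.
have P0 : 0 < p%:Z ^+ i :> int by rewrite exprn_gt0 // ltz_nat ltnW.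
case: (boolP (p ^ i.+1 %| k)%N) => [pk|/negbTE pNk].
  by rewrite ram_dvd // ger0_norm.
case: (boolP (p ^ i %| k)%N) => [pk|/negbTE pNk'].
  by rewrite ram_exact // normrN totient_pXS // ger0_norm ?(ltW P0) //; move: (p%:Z ^+ i) P0 => P P0; nia.
by rewrite ram_ndvd // normr0.
Qed.

Lemma weightS (S : nat -> bool) (a : nat) :
  weight p S a.+1 = weight p S a + p%:Z ^+ a * (p%:Z - 1) * (S a.+1)%:Z.
Proof. by rewrite /weight big_ord_recr /= totient_pXS. Qed.

Lemma weight_ge0 (S : nat -> bool) (a : nat) : 0 <= weight p S a.
Proof. by apply: sumr_ge0 => i _. Qed.

(** The numbers phi(p^i), i <= a, add up to p^a, and S 0 accounts for one unit. *)
Lemma weight_le (S : nat -> bool) (a : nat) :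
  weight p S a <= p%:Z ^+ a - (~~ S 0)%:Z.
Proof.
elim: a => [|a IH].
  by rewrite /weight big_ord_recl big_ord0 /= totient_pX0; case: (S 0).
rewrite weightS exprS; have := prime_gt1 pp.
have : 0 <= p%:Z ^+ a :> int by rewrite exprn_ge0.
by case: (S a.+1); nia.
Qed.

Lemma weight_gt0 (S : nat -> bool) (a i : nat) :
  (i <= a)%N -> S i -> 0 < weight p S a.
Proof.
move=> ia Si; have lt : (i < a.+1)%N by [].
rewrite /weight (bigD1 (Ordinal lt)) //= Si mulr1 ltr_wpDr //.
  by apply: sumr_ge0.
by rewrite ltz_nat totient_gt0 expn_gt0 prime_gt0.
Qed.

End PrimePowers.

Section Levels.
Variables (p q : nat).
Hypotheses (pp : prime p) (pq : prime q) (ltpq : (p < q)%N).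

Lemma eq_eigval (S S' R R' : nat -> bool) (a k k' : nat) :
  (forall i, (i <= a)%N -> S i = S' i) -> (forall i, (i <= a)%N -> R i = R' i) ->
  (forall i, (i <= a)%N -> (p ^ i %| k)%N = (p ^ i %| k')%N) ->
  (q %| k)%N = (q %| k')%N ->
  eigval p q S R a k = eigval p q S' R' a k'.
Proof.
move=> eS eR ep eq; apply: eq_bigr => i _.
have ia : (i <= a)%N by rewrite -ltnS.
rewrite eS // eR // eq; congr (_ * _); case: (val i) ia => [|j] ja //=.
by rewrite !ep // ltnW.
Qed.

Lemma eigval_gcd (S R : nat -> bool) (a k : nat) :
  eigval p q S R a (gcdn k (p ^ a * q)) = eigval p q S R a k.
Proof.
apply: eq_eigval => // [i ia|]; rewrite dvdn_gcd.
  by rewrite (pX_dvd_pXq pp pq ltpq) ia andbT.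
by rewrite dvdn_mull // andbT.
Qed.

Lemma eigmult_levels (S R : nat -> bool) (a : nat) (z : int) :
  eigmult p q S R a z = \sum_(i < a.+1) (totient (p ^ i))%:Z *
    ((eigdiv p q S R a i == z)%:Z + (q.-1)%:Z * (eigndiv p q S R a i == z)%:Z).
Proof.
by rewrite /eigmult (@sum_gcd _ _ pp pq ltpq a (fun k => (eigval p q S R a k == z)%:Z))
  // => k; rewrite eigval_gcd.
Qed.

Lemma eigvalS (S R : nat -> bool) (a k : nat) :
  eigval p q S R a.+1 k = eigval p q S R a k
    + ram p a.+1 k * ((S a.+1)%:Z * ((q * (q %| k))%N%:Z - 1) + (R a.+1)%:Z).
Proof. by rewrite /eigval big_ord_recr. Qed.

Lemma eigndiv0 (S R : nat -> bool) (a : nat) :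
  eigndiv p q S R a 0 = weight p R a - weight p S a.
Proof.
rewrite /eigndiv subn0 /eigval /weight -sumrB; apply: eq_bigr => i _.
rewrite (@ram_dvd p pp i) ?dvdn_exp2l ?leq_ord // qNdvd_pX // muln0; ring.
Qed.

Lemma eigdiv0 (S R : nat -> bool) (a : nat) :
  eigdiv p q S R a 0 = (q%:Z - 1) * weight p S a + weight p R a.
Proof.
rewrite /eigdiv subn0 /eigval /weight mulr_sumr -big_split /=; apply: eq_bigr => i _.
rewrite (@ram_dvd p pp i) ?pX_dvd_pXq ?leq_ord // dvdn_mull // muln1; ring.
Qed.

(** Ramanujan sums are bounded by their value at 0: level 0 carries the degree. *)
Lemma eigval_le (S R : nat -> bool) (a k : nat) :
  eigval p q S R a k <= eigdiv p q S R a 0.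
Proof.
rewrite /eigdiv subn0 /eigval; apply: ler_sum => i _.
rewrite [X in _ <= X * _](@ram_dvd p pp i) ?pX_dvd_pXq ?leq_ord //.
rewrite [in X in _ <= X]dvdn_mull // muln1.
apply: le_trans (ler_norm _) _; rewrite normrM ler_pM ?ram_le // ler_norml.
have := prime_gt1 pq.
by case: (S i); case: (R i); case: (q %| k)%N => q1; rewrite ?muln1 ?muln0; lia.
Qed.

(** Passing from p^b q to p^(b+1) q adds the Ramanujan sums of moduli p^(b+1) and
    p^(b+1) q, which are nonzero only at multiples of p^b. Level 0 of the smaller
    graph thus splits into levels 0 and 1 of the larger one. *)
Lemma eigval_top_levels (S R : nat -> bool) (b : nat) :
  let r := eigdiv p q S R b 0 in let s := eigndiv p q S R b 0 in
  let x := (S b.+1)%:Z * (q%:Z - 1) + (R b.+1)%:Z in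
  let y := (R b.+1)%:Z - (S b.+1)%:Z in
  [/\ eigdiv p q S R b.+1 0 = r + p%:Z ^+ b * (p%:Z - 1) * x,
      eigdiv p q S R b.+1 1 = r - p%:Z ^+ b * x,
      eigndiv p q S R b.+1 0 = s + p%:Z ^+ b * (p%:Z - 1) * y
    & eigndiv p q S R b.+1 1 = s - p%:Z ^+ b * y].
Proof.
move=> r s x y; rewrite eigdiv0 eigndiv0 !weightS // /r /s /x /y eigdiv0 eigndiv0.
rewrite /eigdiv /eigndiv !eigvalS subSS subn0.
rewrite -[in X in eigval _ _ _ _ _ X](subn0 b) -/(eigdiv p q S R b 0).
rewrite -[in X in eigval _ _ _ _ _ X](subn0 b) -/(eigndiv p q S R b 0) eigdiv0 eigndiv0.
have p1 := prime_gt1 pp.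
rewrite !ram_exact ?pX_dvd_pXq ?dvdn_Pexp2l ?ltnn //.
by rewrite qNdvd_pX // dvdn_mull // muln0 muln1; split; ring.
Qed.

(** Every level i >= 2 of the larger graph is level i - 1 of the smaller one, with
    the same eigenvalues and p times the multiplicity; only levels 0 and 1 have
    to be corrected. *)
Lemma eigmultS (S R : nat -> bool) (b : nat) (z : int) :
  eigmult p q S R b.+1 z = p%:Z * eigmult p q S R b z
   + ((eigdiv p q S R b.+1 0 == z)%:Z + (p%:Z - 1) * (eigdiv p q S R b.+1 1 == z)%:Z
      - p%:Z * (eigdiv p q S R b 0 == z)%:Z)
   + (q.-1)%:Z * ((eigndiv p q S R b.+1 0 == z)%:Z
      + (p%:Z - 1) * (eigndiv p q S R b.+1 1 == z)%:Z
      - p%:Z * (eigndiv p q S R b 0 == z)%:Z).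
Proof.
rewrite !eigmult_levels big_ord_recl big_ord_recl [in RHS]big_ord_recl /=.
rewrite /bump /= !add1n totient_pXS // !totient_pX0 expr0 !mul1r.
under eq_bigr => i _.
  have lt := ltn_ord i.
  rewrite add1n !add1n /eigdiv /eigndiv !subSS !eigvalS !ram_ndvd; first last.
  - by rewrite pX_dvd_pXq //; lia.
  - by rewrite dvdn_Pexp2l ?prime_gt1 //; lia.
  rewrite !mul0r !addr0 totient_pXS // exprS.
  rewrite -(mulrA p%:Z (p%:Z ^+ i)) -totient_pXS // -mulrA.
  over.
rewrite -mulr_sumr; under [in RHS]eq_bigr do rewrite !add1n /eigdiv /eigndiv.
ring.
Qed.

End Levels.

(** * Two level decompositions of the same measure *)

Section Peeling.
Variable p : nat.
Hypothesis pp : prime p.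

Lemma totient_pX_dvd (t i : nat) : (t < i)%N -> (p%:Z ^+ t %| (totient (p ^ i))%:Z)%Z.
Proof.
case: i => // i; rewrite ltnS => ti; rewrite totient_pXS //.
by rewrite dvdz_mulr // dvdz_exp2l.
Qed.

(** phi(p^i) is divisible by p^t for i > t, so that only level t survives modulo
    p^t once the levels below it are known to vanish. *)
Lemma level_sum_mod (a t : nat) (G : nat -> int) :
  (forall i, (i < t)%N -> G i = 0) ->
  (p%:Z ^+ t %| \sum_(i < a.+1) (totient (p ^ i))%:Z * G i
               - (t <= a)%N%:Z * ((totient (p ^ t))%:Z * G t))%Z.
Proof.
move=> G0; have dv i : i != t -> (p%:Z ^+ t %| (totient (p ^ i))%:Z * G i)%Z.
  case: ltngtP => // h _; first by rewrite G0 // mulr0 dvdz0.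
  by rewrite dvdz_mulr // totient_pX_dvd.
case: leqP => [ta|ta]; last first.
  rewrite mul0r subr0 rpred_sum // => i _; apply: dv.
  by rewrite ltn_eqF // (leq_trans _ ta).
have lt : (t < a.+1)%N by [].
rewrite (bigD1 (Ordinal lt)) //= mul1r addrAC subrr add0r.
by rewrite rpred_sum // => i iN; apply: dv; rewrite -val_eqE in iN.
Qed.

(** Modulo p the levels 0 and 1 both survive, because phi(p) = p - 1. *)
Lemma level_sum_mod_p (b : nat) (G : nat -> int) :
  (p%:Z %| \sum_(i < b.+2) (totient (p ^ i))%:Z * G i
               - (G 0%N + (p%:Z - 1) * G 1%N))%Z.
Proof.
rewrite !big_ord_recl /= totient_pX0 mul1r /bump /= totient_pXS // expr0 mul1r.
rewrite addrA; set u := G 0%N + _; rewrite addrAC subrr add0r rpred_sum // => i _.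
by rewrite dvdz_mulr // -[p%:Z]expr1 totient_pX_dvd.
Qed.

Lemma Ndvd_unit : ~~ (p%:Z %| p%:Z - 1)%Z.
Proof.
have -> : p%:Z - 1 = (p.-1)%:Z by have := prime_gt0 pp; lia.
by rewrite dvdzE gtnNdvd //; have := prime_gt1 pp; lia.
Qed.

Variable q : nat.
Hypothesis q1 : (1 < q)%N.

Let e := logn p q.-1.

Lemma pXlogn_dvd : (p%:Z ^+ e %| (q.-1)%:Z)%Z.
Proof. by rewrite -PoszX dvdzE pfactor_dvdnn. Qed.

(** q - 1 is p^e times a number prime to p. *)
Lemma pXlogn_Ndvd (u : int) : ~~ (p%:Z %| u)%Z -> ~~ (p%:Z ^+ e.+1 %| (q.-1)%:Z * u)%Z.
Proof.
have q0 : (0 < q.-1)%N by rewrite -subn1 subn_gt0.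
have [c cop qE] := pfactor_coprime pp q0.
rewrite qE PoszM PoszX -/e exprS -mulrA [_ ^+ e * u]mulrC mulrA.
rewrite dvdz_mul2r ?expf_neq0 //; last by rewrite -lt0n prime_gt0.
by rewrite Gauss_dvdzr.
Qed.

Variables (b : nat) (A A' B B' : nat -> int).
Hypothesis same : forall z,
  \sum_(i < b.+2) (totient (p ^ i))%:Z * ((A i == z)%:Z + (q.-1)%:Z * (B i == z)%:Z) =
  \sum_(i < b.+2) (totient (p ^ i))%:Z * ((A' i == z)%:Z + (q.-1)%:Z * (B' i == z)%:Z).
Hypothesis same0 : A 0%N = A' 0%N.

Lemma levels_diff z :
  \sum_(i < b.+2) (totient (p ^ i))%:Z * ((A i == z)%:Z - (A' i == z)%:Z)
  + (q.-1)%:Z *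
  \sum_(i < b.+2) (totient (p ^ i))%:Z * ((B i == z)%:Z - (B' i == z)%:Z) = 0.
Proof.
have /eqP := same z; rewrite -subr_eq0 -sumrB => /eqP sE.
rewrite -[RHS]sE mulr_sumr -big_split /=; apply: eq_bigr => i _; ring.
Qed.

(** Modulo p^i with i <= e the B part vanishes, being multiplied by q - 1; by
    induction only level i of the A part is left, with the coefficient
    phi(p^i) = p^(i-1) (p - 1), which is nonzero modulo p^i. *)
Lemma eq_div_levels i : (i <= e)%N -> (i <= b.+1)%N -> A i = A' i.
Proof.
elim/ltn_ind: i => [[|i] IH] ie ib //; set t := i.+1.
have G0 z j : (j < t)%N -> (A j == z)%:Z - (A' j == z)%:Z = 0.
  move=> jt; rewrite IH ?subrr //; first by rewrite (leq_trans _ ie) // ltnW.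
  by rewrite (leq_trans _ ib) // ltnW.
apply/eqP/negP => /negP ne.
have /(level_sum_mod b.+1) := G0 (A t); have := levels_diff (A t).
move=> /(canRL (addrK _)) ->; rewrite sub0r eqxx [A' t == _]eq_sym (negbTE ne) ib.
rewrite subr0 mulr1 mul1r -opprD rpredN rpredDl; last first.
  rewrite dvdz_mulr //; apply: dvdz_trans pXlogn_dvd.
  by rewrite dvdz_exp2l.
rewrite totient_pXS // exprSr dvdz_mul2l ?expf_neq0 //; last first.
  by rewrite -lt0n prime_gt0.
have -> : p%:Z - 1 = (p.-1)%:Z by have := prime_gt0 pp; lia.
rewrite dvdzE /= => /dvdn_leq; have := prime_gt1 pp; lia.
Qed.

(** The first modulus at which the B part is visible. The factor (e <= b) covers
    the case in which there is no level e + 1. *)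
Lemma levels_congr z :
  (p%:Z ^+ e.+1 %|
    (e <= b)%N%:Z * ((totient (p ^ e.+1))%:Z * ((A e.+1 == z)%:Z - (A' e.+1 == z)%:Z))
   + (q.-1)%:Z * (((B 0%N == z)%:Z - (B' 0%N == z)%:Z)
                  + (p%:Z - 1) * ((B 1%N == z)%:Z - (B' 1%N == z)%:Z)))%Z.
Proof.
have [eb|be] := leqP e b; last first.
  have G0 j : (j < b.+2)%N -> (A j == z)%:Z - (A' j == z)%:Z = 0.
    by move=> jb; rewrite eq_div_levels ?subrr //; lia.
  have := levels_diff z; rewrite big1 ?add0r; last by move=> i _; rewrite G0 ?mulr0.
  rewrite mul0r add0r => sB.
  have := dvdz_mul pXlogn_dvd (level_sum_mod_p b (fun i => (B i == z)%:Z - (B' i == z)%:Z)).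
  by rewrite mulrBr sB sub0r rpredN -exprSr.
have G0 j : (j < e.+1)%N -> (A j == z)%:Z - (A' j == z)%:Z = 0.
  by move=> jb; rewrite eq_div_levels ?subrr //; lia.
have := dvdz_mul pXlogn_dvd (level_sum_mod_p b (fun i => (B i == z)%:Z - (B' i == z)%:Z)).
rewrite mulrBr -exprSr => d2; have := level_sum_mod b.+1 G0; rewrite ltnS eb => d1.
have := rpredD d1 d2; rewrite addrACA levels_diff add0r -opprD.
by rewrite rpredN.
Qed.

(** Otherwise the two pairs at distance h would be four distinct points, each with
    a nonzero coefficient modulo p^(e+1) in the B part, and A_(e+1), A'_(e+1)
    can cancel at most two of them. *)
Lemma eq_ndiv_level0 (h : int) :
  B 0%N - B 1%N = h -> B' 0%N - B' 1%N = h ->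
  `|B 0%N - B' 0%N| < `|h| -> B 0%N = B' 0%N.
Proof.
move=> Bh B'h lt; apply/eqP/negP => /negP /eqP ne.
have nd1 : ~~ (p%:Z %| 1)%Z by rewrite dvdzE dvdn1 neq_ltn prime_gt1 ?orbT.
have nd2 := Ndvd_unit.
(* Points with a B coefficient (q - 1) u, u prime to p, must be cancelled by one
   of the two surviving A levels. *)
have cov z u : (B 0%N == z)%:Z - (B' 0%N == z)%:Z
      + (p%:Z - 1) * ((B 1%N == z)%:Z - (B' 1%N == z)%:Z) = u ->
    ~~ (p%:Z %| u)%Z -> z = A e.+1 \/ z = A' e.+1.
  move=> uE nu; have [->|/negbTE h1] := eqVneq (A e.+1) z; first by left.
  have [->|/negbTE h2] := eqVneq (A' e.+1) z; first by right.
  have := levels_congr z; rewrite uE h1 h2 subrr !mulr0 add0r.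
  by rewrite (negbTE (pXlogn_Ndvd nu)).
have b01 : (B 0%N == B 1%N) = false by apply/eqP; lia.
have b00 : (B 0%N == B' 0%N) = false by apply/eqP; lia.
have b0' : (B 0%N == B' 1%N) = false by apply/eqP; lia.
have b1' : (B 1%N == B' 0%N) = false by apply/eqP; lia.
have b11 : (B 1%N == B' 1%N) = false by apply/eqP; lia.
have b'' : (B' 0%N == B' 1%N) = false by apply/eqP; lia.
have sy (x y : int) : (x == y) = false -> (y == x) = false by rewrite eq_sym.
have E := (b01, b00, b0', b1', b11, b'', sy _ _ b01, sy _ _ b00, sy _ _ b0',
           sy _ _ b1', sy _ _ b11, sy _ _ b'', eqxx).
have := cov (B 0%N) 1; have := cov (B' 0%N) (-1).
have := cov (B 1%N) (p%:Z - 1); have := cov (B' 1%N) (- (p%:Z - 1)).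
rewrite !E !rpredN !(sub0r, subr0, subrr, mulr0, mulr1, mulrN1, addr0, add0r).
move=> /(_ erefl nd2) h1 /(_ erefl nd2) h2 /(_ erefl nd1) h3 /(_ erefl nd1) h4.
move/eqP: b01; move/eqP: b00; move/eqP: b0'; move/eqP: b1'; move/eqP: b11; move/eqP: b''.
by case: h1 => ->; case: h2 => ->; case: h3 => ->; case: h4 => ->.
Qed.
End Peeling.

(** * Recovering the top divisors and the quotient measure *)

Section Comparison.
Variables (p q : nat).
Hypotheses (pp : prime p) (pq : prime q) (ltpq : (p < q)%N).

(** The largest eigenvalue of the right-hand family has positive multiplicity (it
    is attained at k = 0), hence is also an eigenvalue of the left-hand one. *)
Lemma eigmult_top_le (S R S' R' : nat -> bool) (a : nat) :
  (forall z, eigmult p q S R a z = eigmult p q S' R' a z) ->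
  eigdiv p q S' R' a 0 <= eigdiv p q S R a 0.
Proof.
move=> same; rewrite leNgt; apply/negP => lt.
have := same (eigdiv p q S' R' a 0).
rewrite /eigmult [LHS]big1; last first.
  move=> k _; case: eqP => // kE; move: lt.
  by rewrite -kE ltNge eigval_le.
rewrite big_ltn ?muln_gt0 ?expn_gt0 ?prime_gt0 //.
rewrite -[eigval p q S' R' a 0](eigval_gcd pp pq ltpq) gcd0n /eigdiv subn0 eqxx => /eqP.
by rewrite lt_eqF // ltr_wpDr // sumr_ge0.
Qed.

(** R 0 = false, i.e. the order of the graph is not an element of D, makes the
    upper bound strict; this strictness is what keeps |s - s'| below 2P. *)
Lemma eigndiv0_bounds (S R : nat -> bool) (b : nat) : R 0%N = false ->
  - p%:Z ^+ b <= eigndiv p q S R b 0 < p%:Z ^+ b.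
Proof.
move=> R0; rewrite eigndiv0 //.
have := weight_le pp S b; have := weight_le pp R b; rewrite R0 /=.
have := weight_ge0 p S b; have := weight_ge0 p R b.
by case: (S 0%N) => /=; lia.
Qed.

Variables (b : nat).

(** For e = 0, i.e. p prime to q - 1, the measure modulo p tells the nonempty
    sets T apart. The first graph has T = {1} or T = {q}; the second has
    y' = 0, or T = {1} and T' = {q}. At z = B_0 the congruence
    fails: the terms that can meet z leave its coefficient a unit modulo p. *)
Lemma no_top_clash (S R S' R' : nat -> bool) :
  R 0%N = false -> R' 0%N = false -> 0 < weight p S' b.+1 ->
  (forall z, eigmult p q S R b.+1 z = eigmult p q S' R' b.+1 z) ->
  logn p q.-1 = 0%N ->
  R b.+1 != S b.+1 ->
  (R' b.+1 == S' b.+1) || [&& S b.+1, ~~ R b.+1, ~~ S' b.+1 & R' b.+1] ->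
  False.
Proof.
move=> R0 R0' U'0 same e0 y0 bits.
have /andP[sl su] := eigndiv0_bounds S b R0.
have /andP[sl' su'] := eigndiv0_bounds S' b R0'.
have A00 : eigdiv p q S R b.+1 0 = eigdiv p q S' R' b.+1 0.
  by apply/eqP; rewrite eq_le !eigmult_top_le // => z; rewrite same.
have [_ A1 B0 B1] := eigval_top_levels pp pq ltpq S R b.
have [A0' A1' B0' B1'] := eigval_top_levels pp pq ltpq S' R' b.
have W0 : 0 < p%:Z ^+ b :> int by rewrite exprn_gt0 // ltz_nat prime_gt0.
have [p1 q1] := (prime_gt1 pp, prime_gt1 pq).
have p2 : p != 2%N.
  apply/eqP => pE; have : (0 < logn p q.-1)%N.
    have [q2|oq] := even_prime pq; first by move: ltpq; rewrite q2 pE.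
    rewrite logn_gt0 mem_primes pp pE dvdn2 /= -subn1 subn_gt0 q1 /=.
    by rewrite oddB ?oq // ltnW.
  by rewrite e0.
have nd1 : ~~ (p%:Z %| 1)%Z by rewrite dvdzE dvdn1 neq_ltn p1 orbT.
have ndq : ~~ (p%:Z %| q%:Z)%Z by rewrite dvdzE dvdn_prime2 // ltn_eqF.
have nd2 : ~~ (p%:Z %| 2)%Z by rewrite dvdzE dvdn_prime2.
set z := eigndiv p q S R b.+1 0 in B0.
(* A_1 - B_0 is a multiple of q plus or minus p^(b+1). *)
have A1z : (eigdiv p q S R b.+1 1 == z) = false.
  apply/eqP => A1E; have : (q%:Z %| p%:Z ^+ b.+1)%Z.
    apply/dvdzP; move: A1E; rewrite A1 B0 eigdiv0 // eigndiv0 // exprS.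
    case: (S b.+1) (R b.+1) y0 => [] [] //= _ E1.
      by exists (p%:Z ^+ b - weight p S b); move: E1; clear; lia.
    by exists (weight p S b); move: E1; clear; lia.
  by rewrite -PoszX dvdzE /= qNdvd_pX.
have levels := fun z => etrans (esym (eigmult_levels pp pq ltpq S R b.+1 z))
  (etrans (same z) (eigmult_levels pp pq ltpq S' R' b.+1 z)).
have := levels_congr pp q1 levels A00 z.
have nd := pXlogn_Ndvd pp q1.
rewrite e0 expr1 in nd *.
rewrite leq0n totient_pXS // expr0 !mul1r A1z eqxx.
have -> : (eigndiv p q S R b.+1 1 == z) = false.
  apply/eqP; rewrite B1 B0; have : 0 < p%:Z ^+ b * p%:Z by rewrite mulr_gt0 // ltz_nat ltnW.
  by case: (S b.+1) (R b.+1) y0 => [] [] //= _; clear; lia.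
rewrite /= !sub0r.
set c := (eigdiv p q S' R' b.+1 1 == z); set t := (eigndiv p q S' R' b.+1 1 == z).
have qE : (q.-1)%:Z = q%:Z - 1 by move: q1; clear; lia.
(* What remains is to see that the coefficient at z is a unit modulo p. *)
have dvdq (v : int) : (p%:Z %| q%:Z - p%:Z * v)%Z -> False.
  by rewrite rpredBr ?dvdz_mulr // (negbTE ndq).
case/orP: bits => [/eqP y0'|/and4P[S1 R1 S'1 R'1]].
  have -> : (eigndiv p q S' R' b.+1 0 == z) = t by rewrite /t B0' B1' y0' subrr !mulr0.
  have ndt : ~~ (p%:Z %| 1 - p%:Z * t%:Z)%Z by rewrite rpredBr // dvdz_mulr.
  move: (nd _ ndt) => /negP H D.
  case: c D => D; last first.
    apply: H; rewrite qE in D *; move: D; congr (is_true (_ %| _)%Z).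
    by move: (t); clear; case; lia.
  apply: (dvdq (1 + (q%:Z - 1) * t%:Z)).
  rewrite qE in D; move: D; congr (is_true (_ %| _)%Z).
  by move: (t); clear; case; lia.
(* The sizes separate the two candidates: B_0 = s - P(p-1) is smaller than
   B'_0 = s' + P(p-1). *)
have s00 : (eigndiv p q S' R' b.+1 0 == z) = false.
  apply/eqP; rewrite B0 B0' S1 (negbTE S'1) R'1 (negbTE R1) /=.
  have : p%:Z ^+ b * 2 <= p%:Z ^+ b * p%:Z by rewrite ler_wpM2l // ltW.
  by move: sl su sl' su'; clear; lia.
(* A'_1 = B'_1 would give A'_0 = B'_0, against the positive weight. *)
have ct : c -> t -> False.
  move=> /eqP Ac /eqP Bt; have : q%:Z * weight p S' b.+1 = 0.
    have -> : q%:Z * weight p S' b.+1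
            = eigdiv p q S' R' b.+1 0 - eigndiv p q S' R' b.+1 0.
      by rewrite eigdiv0 // eigndiv0 //; ring.
    move: Ac Bt; rewrite A0' A1' B0' B1' R'1 (negbTE S'1) /=; clear; lia.
  by apply/eqP; rewrite mulf_neq0 // gt_eqF // ltz_nat ltnW.
rewrite s00 => D.
case cE : c ct D => ct D.
  have tE : t = false by apply/negbTE/negP => /(ct isT).
  apply: (dvdq 1); rewrite qE tE in D; move: D; congr (is_true (_ %| _)%Z).
  by clear; lia.
case tE : t D => D; last first.
  by have := nd _ nd1; rewrite qE in D *; move/negP; apply; move: D; congr (is_true (_ %| _)%Z); clear; lia.
have nd2p : ~~ (p%:Z %| 2 - p%:Z)%Z by rewrite rpredBr.
have := nd _ nd2p; rewrite qE in D *; move/negP; apply; move: D.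
by congr (is_true (_ %| _)%Z); clear; lia.
Qed.

End Comparison.

Section SameSpectrum.
Variables (p q b : nat).
Hypotheses (pp : prime p) (pq : prime q) (ltpq : (p < q)%N).
Variables (S R S' R' : nat -> bool).
Hypotheses (R0 : R 0%N = false) (R0' : R' 0%N = false).
Hypotheses (U0 : 0 < weight p S b.+1) (U0' : 0 < weight p S' b.+1).
Hypotheses (T0 : S b.+1 || R b.+1) (T0' : S' b.+1 || R' b.+1).
Hypothesis same : forall z, eigmult p q S R b.+1 z = eigmult p q S' R' b.+1 z.

Let q1 : (1 < q)%N := prime_gt1 pq.

Lemma eq_degree : eigdiv p q S R b.+1 0 = eigdiv p q S' R' b.+1 0.
Proof. by apply/eqP; rewrite eq_le !eigmult_top_le // => z; rewrite same. Qed.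

Lemma eq_levels z :
  \sum_(i < b.+2) (totient (p ^ i))%:Z *
    ((eigdiv p q S R b.+1 i == z)%:Z + (q.-1)%:Z * (eigndiv p q S R b.+1 i == z)%:Z)
  = \sum_(i < b.+2) (totient (p ^ i))%:Z *
    ((eigdiv p q S' R' b.+1 i == z)%:Z + (q.-1)%:Z * (eigndiv p q S' R' b.+1 i == z)%:Z).
Proof. by rewrite -!eigmult_levels. Qed.

(** If p divides q - 1, then A_1 = A'_1 and hence x = x', and x takes distinct
    values on the four possible sets T because q > 2. *)
Lemma eq_top_bits : S b.+1 = S' b.+1 /\ R b.+1 = R' b.+1.
Proof.
have [e0|e0] := posnP (logn p q.-1).
  have aux := no_top_clash pp pq ltpq R0 R0' U0' same e0.
  have aux' := no_top_clash pp pq ltpq R0' R0 U0 (fun z => esym (same z)) e0.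
  move: T0 T0' aux aux'.
  by case: (S b.+1) (R b.+1) (S' b.+1) (R' b.+1) => [] [] [] [] //= _ _ h1 h2;
    [case: h2|case: h2|case: h1|case: h1|case: h1|case: h2].
have := eq_div_levels pp q1 eq_levels eq_degree e0 isT.
have := eq_degree.
have [-> -> _ _] := eigval_top_levels pp pq ltpq S R b.
have [-> -> _ _] := eigval_top_levels pp pq ltpq S' R' b.
have Wp : p%:Z ^+ b * p%:Z != 0 by rewrite mulf_neq0 ?expf_neq0 // -lt0n prime_gt0.
set x := _ + (R b.+1)%:Z; set x' := _ + (R' b.+1)%:Z => E0 E1.
have xE : x = x'.
  by apply: (mulfI Wp); move: E0 E1; clear; lia.
have := prime_gt1 pp; move: ltpq T0 T0' xE; rewrite /x /x'; clear.
by case: (S b.+1) (R b.+1) (S' b.+1) (R' b.+1) => [] [] [] [] //=; lia.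
Qed.

Lemma eq_quotient_ndiv0 : S b.+1 != R b.+1 -> eigndiv p q S R b 0 = eigndiv p q S' R' b 0.
Proof.
move=> y0; have [SE RE] := eq_top_bits.
have /andP[sl su] := eigndiv0_bounds pp pq ltpq S b R0.
have /andP[sl' su'] := eigndiv0_bounds pp pq ltpq S' b R0'.
have [_ _ B0 B1] := eigval_top_levels pp pq ltpq S R b.
have [_ _ B0' B1'] := eigval_top_levels pp pq ltpq S' R' b.
rewrite -SE -RE in B0' B1'.
pose h := p%:Z ^+ b * p%:Z * ((R b.+1)%:Z - (S b.+1)%:Z).
have hE : eigndiv p q S R b.+1 0 - eigndiv p q S R b.+1 1 = h.
  by rewrite B0 B1 /h; ring.
have hE' : eigndiv p q S' R' b.+1 0 - eigndiv p q S' R' b.+1 1 = h.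
  by rewrite B0' B1' /h; ring.
suff lt : `|eigndiv p q S R b.+1 0 - eigndiv p q S' R' b.+1 0| < `|h|.
  have := eq_ndiv_level0 pp q1 eq_levels eq_degree hE hE' lt.
  by rewrite B0 B0' => /addIr.
have hN : `|h| = p%:Z ^+ b * p%:Z.
  have y1 : `|(R b.+1)%:Z - (S b.+1)%:Z| = 1.
    by case: (S b.+1) (R b.+1) y0 => [] [].
  by rewrite /h normrM y1 mulr1 ger0_norm // mulr_ge0 // exprn_ge0.
have W0 : 0 < p%:Z ^+ b :> int by rewrite exprn_gt0 // ltz_nat prime_gt0.
have : p%:Z ^+ b * 2 <= p%:Z ^+ b * p%:Z.
  by have p1 := prime_gt1 pp; rewrite ler_wpM2l // ltW.
rewrite hN B0 B0' ltr_norml; move: sl su sl' su'; clear; lia.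
Qed.

(** In [eigmultS] the correction at the B levels vanishes when y = 0; otherwise
    it is the same on both sides because s = s'. *)
Lemma eq_eigmult_quotient z : eigmult p q S R b z = eigmult p q S' R' b z.
Proof.
have p0 : p%:Z != 0 by rewrite -lt0n prime_gt0.
have [SE RE] := eq_top_bits.
have := same z; rewrite !eigmultS // eq_degree.
have A1E : eigdiv p q S R b.+1 1 = eigdiv p q S' R' b.+1 1
   /\ eigdiv p q S R b 0 = eigdiv p q S' R' b 0.
  have := eq_degree.
  have [-> -> _ _] := eigval_top_levels pp pq ltpq S R b.
  have [-> -> _ _] := eigval_top_levels pp pq ltpq S' R' b.
  by rewrite SE RE => /addIr ->.
rewrite A1E.1 A1E.2.
set bot := (X in _ + _ * X = _ -> _); set bot' := (X in _ = _ + _ * X -> _).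
have -> : bot = bot'.
  rewrite /bot /bot'.
  have [_ _ -> ->] := eigval_top_levels pp pq ltpq S R b.
  have [_ _ -> ->] := eigval_top_levels pp pq ltpq S' R' b.
  rewrite -SE -RE; have [SR|/eq_quotient_ndiv0 -> //] := eqVneq (S b.+1) (R b.+1).
  by rewrite SR subrr !(mulr0, oppr0, addr0); ring.
by move=> /addIr /addIr /(mulfI p0).
Qed.
End SameSpectrum.

(** * Connected graphs and the decomposition of the divisor set *)

(** If l divided all of D, the residue modulo l would be constant along edges,
    and 0 and 1 would lie in different components. *)
Lemma connected_coprime (n l : nat) (D : {fset nat}) : (1 < n)%N -> prime l ->
  (l %| n)%N -> graph_connected (ICG n D) -> exists2 d, d \in D & ~~ (l %| d)%N.
Proof.
move=> n1 pl ln conn; case: (boolP (all (dvdn l) D)) => [/allP allD|]; last first.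
  by case/allPn => d dD ld; exists d.
have cl : closed (ICG n D) [pred x : 'Z_n | (l %| x)%N].
  move=> x y; rewrite /ICG => /allD; rewrite !inE dvdn_gcd ln andbT => lxy.
  have lZ (u v : 'Z_n) : (l %| (u + v)%R)%N = (l %| u + v)%N.
    by rewrite /= [X in (_ %% X)%N]Zp_cast // /dvdn modn_dvdm.
  by rewrite -[X in (l %| nat_of_ord X)%N = _](subrK y) lZ dvdn_addr.
have := closed_connect cl (conn 0 1); rewrite !inE /= dvdn0 modn_small //.
by rewrite dvdn1 => /esym /eqP lE; rewrite lE in pl.
Qed.

Lemma eigmult_int_mult (p q a : nat) (D : {fset nat}) (z : int) :
  prime p -> prime q -> (p < q)%N ->
  (int_mult (ICG (p ^ a * q) D) z)%:Z
   = eigmult p q (fun i => (p ^ (a - i))%N \in D)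
                 (fun i => (p ^ (a - i) * q)%N \in D) a z.
Proof.
move=> pp pq ltpq; rewrite int_mult_ICG // /eigmult -natz natr_sum.
by apply: eq_bigr => k _; rewrite natz.
Qed.

Lemma eq_eigmult (p q a : nat) (S S' R R' : nat -> bool) (z : int) :
  (forall i, (i <= a)%N -> S i = S' i) -> (forall i, (i <= a)%N -> R i = R' i) ->
  eigmult p q S R a z = eigmult p q S' R' a z.
Proof.
by move=> eS eR; apply: eq_bigr => k _; rewrite (eq_eigval (S' := S') (R' := R') (k' := k)).
Qed.

Section Decomposition.
Variables (p q b : nat) (D E T : {fset nat}).
Hypotheses (pp : prime p) (pq : prime q) (ltpq : (p < q)%N).
Hypothesis DS : D `<=` Divstar (p ^ b.+1 * q).
Hypothesis dec : decomposition p q b.+1 D E T.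
Hypothesis conn : graph_connected (ICG (p ^ b.+1 * q) D).

Let n1 : (1 < p ^ b.+1 * q)%N.
Proof. by rewrite (leq_trans (prime_gt1 pq)) // leq_pmull ?expn_gt0 ?prime_gt0. Qed.

Lemma mem_dvd d : d \in D -> (d %| p ^ b.+1 * q)%N /\ (d < p ^ b.+1 * q)%N.
Proof.
move/(fsubsetP DS); rewrite !inE /= -dvdn_divisors ?(ltnW n1) //.
by case/andP.
Qed.

Lemma mulp_in (e : nat) : ((p * e)%N \in D) = (e \in E).
Proof.
case: dec => _ TE _ DE; rewrite DE inE mem_imfset /=; last first.
  by move=> x y /eqP; rewrite eqn_pmul2l ?prime_gt0 // => /eqP.
rewrite TE !inE; case: (e \in E) => //=; apply/negbTE; rewrite negb_and.
apply/orP; right; apply/negP => /orP[] /eqP h.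
  by have := dvdn_mulr e (dvdnn p); rewrite h dvdn1 gtn_eqF // prime_gt1.
by have := dvdn_mulr e (dvdnn p); rewrite h dvdn_prime2 // ltn_eqF.
Qed.

Lemma order_notin : ((p ^ (b.+1 - 0) * q)%N \in D) = false.
Proof. by rewrite subn0; apply/negP => /mem_dvd[_]; rewrite ltnn. Qed.

Lemma connected_top_bits :
  ((p ^ (b.+1 - b.+1))%N \in D) || ((p ^ (b.+1 - b.+1) * q)%N \in D).
Proof.
have [|d dD pd] := connected_coprime n1 pp _ conn.
  by rewrite expnS -mulnA dvdn_mulr.
rewrite subnn expn0 mul1n; have [dn _] := mem_dvd dD.
case: (dvd_pXq pp pq dn) => j _ dE; have j0 : j = 0%N.
  case: j dE => // j dE; case/negP: pd.
  by case: dE => ->; rewrite expnS -?mulnA dvdn_mulr.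
by move: dD; case: dE => ->; rewrite j0 expn0 ?mul1n => ->; rewrite ?orbT.
Qed.

Lemma connected_weight : 0 < weight p (fun i => (p ^ (b.+1 - i))%N \in D) b.+1.
Proof.
have [|d dD qd] := connected_coprime n1 pq _ conn; first by rewrite dvdn_mull.
have [dn _] := mem_dvd dD; case: (dvd_pXq pp pq dn) => j jb dE.
apply: (@weight_gt0 _ pp _ _ (b.+1 - j)); first exact: leq_subr.
rewrite subKn //; case: dE => dE; first by rewrite -dE.
by rewrite dE dvdn_mull in qd.
Qed.

(** The divisor e of p^b q and the divisor pe of p^(b+1) q have the same
    cofactor, so that H is described by the S and R of G. *)
Lemma eigmult_quotient z :
  (int_mult (ICG (p ^ b * q) E) z)%:Z
   = eigmult p q (fun i => (p ^ (b.+1 - i))%N \in D)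
                 (fun i => (p ^ (b.+1 - i) * q)%N \in D) b z.
Proof.
rewrite eigmult_int_mult //; apply: eq_eigmult => i ib.
  by rewrite subSn // expnS mulp_in.
by rewrite subSn // expnS -mulnA mulp_in.
Qed.

End Decomposition.

Local Close Scope ring_scope.

Theorem theorem4p12 (p q a : nat) (D D' E E' T T' : {fset nat}) :
  prime p -> prime q -> p < q -> 0 < a ->
  D `<=` Divstar (p ^ a * q) -> D' `<=` Divstar (p ^ a * q) ->
  decomposition p q a D E T -> decomposition p q a D' E' T' ->
  graph_connected (ICG (p ^ a * q) D) ->
  graph_connected (ICG (p ^ a * q) D') ->
  spectrum (ICG (p ^ a * q) D) = spectrum (ICG (p ^ a * q) D') ->
  T = T' /\
  spectral_measure (ICG (p ^ a.-1 * q) E) =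
  spectral_measure (ICG (p ^ a.-1 * q) E').
Proof.
move=> pp pq ltpq; case: a => [//|b _] DS DS' dec dec' conn conn' sp.
have mE z : int_mult (ICG (p ^ b.+1 * q) D) z = int_mult (ICG (p ^ b.+1 * q) D') z.
  by rewrite /int_mult sp.
have same z := etrans (esym (eigmult_int_mult b.+1 D z pp pq ltpq))
  (etrans (congr1 Posz (mE z))
          (eigmult_int_mult b.+1 D' z pp pq ltpq)).
have R0 := order_notin pp pq DS; have R0' := order_notin pp pq DS'.
have U0 := connected_weight pp pq DS conn; have U0' := connected_weight pp pq DS' conn'.
have T0 := connected_top_bits pp pq DS conn; have T0' := connected_top_bits pp pq DS' conn'.
split.
  have [] := eq_top_bits pp pq ltpq R0 R0' U0 U0' T0 T0' same.
  rewrite subnn expn0 mul1n => S1 Rq.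
  case: dec dec' => _ -> _ _ [_ -> _ _]; apply/fsetP => d; rewrite !inE.
  by case: eqP => [->|_]; [rewrite S1|case: eqP => [->|_]; [rewrite Rq|rewrite !andbF]].
apply/eqP/freeg_eqP => z; rewrite !coeff_spectral_measure.
rewrite (eigmult_quotient pp pq ltpq dec) (eigmult_quotient pp pq ltpq dec').
exact: eq_eigmult_quotient.
Qed.
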